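(* For all integers $m\geq 1$ and $n\geq 1$, the graph $m\Gamma(\mathbb{Z}_6)+n\Gamma(\mathbb{Z}_4)$ (the join of $m\Gamma(\mathbb{Z}_6)$ and $n\Gamma(\mathbb{Z}_4)$) does not admit a distance antimagic labeling.
   Context: For an integer $n \geq 2$, the zero-divisor graph $\Gamma(\mathbb{Z}_n)$ is the simple graph whose vertex set is the set of nonzero zero-divisors of the ring $\mathbb{Z}_n$, two distinct vertices $u,v$ being adjacent iff $uv \equiv 0 \pmod n$. For a graph $H$ and positive integer $k$, $kH$ denotes the disjoint union of $k$ copies of $H$. For graphs $G,H$, the join $G+H$ is the graph obtained from the disjoint union of $G$ and $H$ by adding every edge between a vertex of $G$ and a vertex of $H$. A distance antimagic labeling (DAML) of a graph $G$ with $N$ vertices is a bijection $f:V(G)\to\{1,\dots,N\}$ such that the weights $w(v)=\sum_{u\in N(v)} f(u)$, where $N(v)$ is the open neighbourhood of $v$, are pairwise distinct over all vertices $v$. A graph admits DAML if such a labeling exists. *)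

(* Defs.v *)
From mathcomp Require Import all_boot all_algebra.

Set Implicit Arguments.
Unset Strict Implicit.
Unset Printing Implicit Defensive.

Import GRing.Theory.

Record sgraph := SGraph {
  vertex :> finType;
  adj : rel vertex;
  adj_sym : symmetric adj;
  adj_irr : irreflexive adj
}.

Section Copies.
Variables (k : nat) (H : sgraph).

Definition copies_adj : rel ('I_k * H)%type :=
  fun x y => (x.1 == y.1) && adj x.2 y.2.

Lemma copies_adj_sym : symmetric copies_adj.
Proof. by move=> x y; rewrite /copies_adj eq_sym adj_sym. Qed.

Lemma copies_adj_irr : irreflexive copies_adj.
Proof. by move=> x; rewrite /copies_adj adj_irr andbF. Qed.

Definition copies : sgraph := SGraph copies_adj_sym copies_adj_irr.
End Copies.

Section Join.
Variables G H : sgraph.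

Definition join_adj : rel (G + H)%type := fun x y =>
  match x, y with
  | inl a, inl b => adj a b
  | inr a, inr b => adj a b
  | inl _, inr _ | inr _, inl _ => true
  end.

Lemma join_adj_sym : symmetric join_adj.
Proof. by move=> [a|a] [b|b] //=; rewrite adj_sym. Qed.

Lemma join_adj_irr : irreflexive join_adj.
Proof. by move=> [a|a] /=; rewrite adj_irr. Qed.

Definition join : sgraph := SGraph join_adj_sym join_adj_irr.
End Join.

(* Meaningful for [1 < n] only: ['Z_0] and ['Z_1] both denote Z/2Z. *)
Section ZeroDivisorGraph.
Local Open Scope ring_scope.
Variable n : nat.

Definition nonzero_zero_divisor : pred 'Z_n :=
  fun x => (x != 0) && [exists y : 'Z_n, (y != 0) && (x * y == 0)].

Definition zd_vertex : finType := {x : 'Z_n | nonzero_zero_divisor x}.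

Definition zd_adj : rel zd_vertex :=
  fun u v => (u != v) && (val u * val v == 0).

Lemma zd_adj_sym : symmetric zd_adj.
Proof. by move=> u v; rewrite /zd_adj eq_sym mulrC. Qed.

Lemma zd_adj_irr : irreflexive zd_adj.
Proof. by move=> u; rewrite /zd_adj eqxx. Qed.

Definition zero_divisor_graph : sgraph := SGraph zd_adj_sym zd_adj_irr.
End ZeroDivisorGraph.

Section DistanceAntimagic.
Variable G : sgraph.

Definition open_nbhd (v : G) : {set G} := [set u | adj v u].

Definition weight (f : G -> nat) (v : G) : nat := \sum_(u in open_nbhd v) f u.

Definition bijective_labeling (f : G -> nat) : Prop :=
  injective f /\ (forall k : nat, 1 <= k <= #|G| <-> exists v : G, f v = k).

Definition is_DAML (f : G -> nat) : Prop :=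
  bijective_labeling f /\ injective (weight f).

Definition admits_DAML : Prop := exists f : G -> nat, is_DAML f.
End DistanceAntimagic.

(* Main.v *)
(* The two leaves 2 and 4 of any copy of Gamma(Z_6), which is the path 2 - 3 - 4,
   have the same neighbourhood, hence the same weight under any labeling; joining
   with another graph enlarges both neighbourhoods by the same vertices. *)
Require Import Defs.
From mathcomp Require Import all_boot.
From mathcomp Require Import all_algebra.

Lemma weight_twins (G : sgraph) (f : G -> nat) (u v : G) :
  adj u =1 adj v -> weight f u = weight f v.
Proof. by move=> Euv; apply: eq_bigl => x; rewrite !inE Euv. Qed.

Lemma twins_not_DAML (G : sgraph) (u v : G) :
  u != v -> adj u =1 adj v -> ~ admits_DAML G.
Proof.
move=> /eqP neq_uv Euv [f [_ inj_w]].
by apply/neq_uv/inj_w/weight_twins.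
Qed.

(** Both vertices carry the same index [i], so [copies_adj] can tell them apart only through [adj]
    in [H]. *)
Lemma twins_copies (k : nat) (H : sgraph) (i : 'I_k) (u v : H) :
  adj u =1 adj v -> adj ((i, u) : copies k H) =1 adj ((i, v) : copies k H).
Proof. by move=> Euv [j x]; rewrite /= /copies_adj /= Euv. Qed.

Lemma twins_joinl (G H : sgraph) (u v : G) :
  adj u =1 adj v -> adj (inl u : join G H) =1 adj (inl v : join G H).
Proof. by move=> Euv [] x /=. Qed.

Lemma zd6_twins : exists u v : zero_divisor_graph 6, u != v /\ adj u =1 adj v.
Proof.
have zd2 : nonzero_zero_divisor (2%:R : 'Z_6)%R.
  (* 2 * 3 = 6 and, below, 4 * 3 = 12 vanish mod 6. *)
  by apply/andP; split=> //; apply/existsP; exists 3%:R%R.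
have zd4 : nonzero_zero_divisor (4%:R : 'Z_6)%R.
  by apply/andP; split=> //; apply/existsP; exists 3%:R%R.
exists (Sub _ zd2), (Sub _ zd4); split=> // -[x zdx].
rewrite /= /zd_adj -!val_eqE /=.
(* Among the residues mod 6, exactly 0 and 3 annihilate 2, and the same two annihilate 4. *)
by case: x zdx => [[|[|[|[|[|[|]]]]]] ltx6] zdx.
Qed.

Theorem theorem2p5 (m n : nat) (hm : 1 <= m) (hn : 1 <= n) :
  ~ admits_DAML
      (join (copies m (zero_divisor_graph 6)) (copies n (zero_divisor_graph 4))).
Proof.
have [u [v [neq_uv Euv]]] := zd6_twins.
(* [hm] unfolds to [0 < m], so [i] is the copy of index 0. *)
pose i := Ordinal hm.
pose leaf w : join (copies m (zero_divisor_graph 6))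
                   (copies n (zero_divisor_graph 4)) := inl (i, w).
apply: (twins_not_DAML _ (leaf u) (leaf v)).
  by apply: contraNneq neq_uv => -[->].
exact/twins_joinl/twins_copies.
Qed.
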